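(* Consider any instance of online bipartite matching with (possibly heterogeneous and overlapping) protected groups under the long-run fairness objective, and let $b=\min_{i\in I}b_i$. Then the competitiveness of the generalized LP-based sampling algorithm SAMP is at least $1-e^{-b}\frac{b^b}{b!}$, i.e. its long-run fairness is at least $1-e^{-b}b^b/b!$ times that of the optimal clairvoyant algorithm. Moreover, $1-e^{-b}b^b/b!$ is increasing in $b$ and tends to $1$ as $b\to\infty$.
   Context: Model: $I$ finite set of offline agents, $J$ finite set of online types, $E\subseteq I\times J$ eligible pairs; $\mathcal N_i=\{j:(i,j)\in E\}$, $\mathcal N_j=\{i:(i,j)\in E\}$. Offline agent $i$ has integer capacity $b_i\ge1$. Online agents of type $j$ arrive by independent Poisson processes of constant rate $\lambda_j>0$ on $[0,1]$; on arrival its type is revealed and an online algorithm must immediately and irrevocably serve it with some $i\in\mathcal N_j$ having remaining capacity, or reject it. A clairvoyant algorithm knows the realized arrivals in advance and assigns (possibly randomly) subject to the same constraints. There is a family $\mathcal G$ of protected groups, each $G\subseteq J$, every type belonging to at least one group. With $X_j$ the number of type-$j$ agents served and $X(G)=\sum_{j\in G}X_j$, the long-run fairness is $\min_{G\in\mathcal G}\mathbb E[X(G)]/\sum_{j\in G}\lambda_j$ (expectation over arrivals and randomness). Competitiveness is the ratio of the algorithm's objective to that of the optimal clairvoyant algorithm. Generalized LP: maximize $s$ subject to $\sum_{j\in\mathcal N_i}x_{ij}\le b_i$ for all $i$; $\sum_{j\in G}\sum_{i\in\mathcal N_j}x_{ij}\ge s\sum_{j\in G}\lambda_j$ for all $G\in\mathcal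 G$; $\sum_{i\in\mathcal N_j}x_{ij}\le\lambda_j$ for all $j$; $s,x_{ij}\ge0$. Algorithm SAMP: compute an optimal solution $x^*$ of the generalized LP. When an agent of type $j$ arrives, pick $i\in\mathcal N_j$ with probability $x^*_{ij}/\lambda_j$ (and pick nothing, i.e. reject, with the remaining probability $1-\sum_{i\in\mathcal N_j}x^*_{ij}/\lambda_j$); if an $i$ was picked and has not reached its capacity, serve the agent with $i$, otherwise reject it. *)

(* Defs.v *)
From HB Require Import structures.
From mathcomp Require Export all_boot all_order all_algebra.
From mathcomp Require Export all_classical all_reals all_analysis.
Export Order.TTheory GRing.Theory Num.Theory.
Export numFieldNormedType.Exports.

Set Implicit Arguments.
Unset Strict Implicit.
Unset Printing Implicit Defensive.

Local Open Scope classical_set_scope.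
Local Open Scope ring_scope.

Section independence.
Context d (T : measurableType d) (R : realType) (P : probability T R).

(* Independence of a family of set systems; here the systems are always
   sigma-algebras, one for each index. *)
Definition independent (K : eqType) (S : K -> set (set T)) : Prop :=
  forall (s : seq K) (A : K -> set T), uniq s ->
    (forall k, k \in s -> S k (A k)) ->
    (P (\bigcap_(k in [set` s]) A k) = \prod_(k <- s) P (A k))%E.

(* Sigma-algebra generated by a random variable with values in a countable
   discrete space: every set of values is measurable. *)
Definition sigma_rv (V : Type) (X : T -> V) : set (set T) :=
  preimage_set_system setT X [set: set V].

(* Homogeneous Poisson process of rate [r] on [0, 1], as a counting process.
   The values of [N] outside [0, 1] are unconstrained.  Subtraction is in [nat]
   but never truncates, because paths are nondecreasing.  A finite time grid is
   an eventually constant [t] in [pp_indep]. *)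
Record poisson_process (r : R) (N : R -> T -> nat) : Prop := PoissonProcess {
  pp_measurable : forall t, 0 <= t <= 1 -> measurable_fun setT (N t);
  pp_zero : forall w, N 0 w = 0%N;
  pp_nondecreasing : forall w s t,
    0 <= s -> s <= t -> t <= 1 -> (N s w <= N t w)%N;
  pp_right_continuous : forall w t,
    0 <= t < 1 -> \forall u \near t^'+, N u w = N t w;
  pp_indep : forall t : nat -> R,
    {homo t : m n / (m <= n)%N >-> m <= n} -> (forall m, 0 <= t m <= 1) ->
    independent (fun m => sigma_rv (fun w => N (t m.+1) w - N (t m) w)%N);
  pp_law : forall s t, 0 <= s -> s < t -> t <= 1 -> forall k : nat,
    P [set w | (N t w - N s w)%N = k] = (poisson_pmf (r * (t - s)) k)%:E }.

Definition independent_poisson_processes (J : finType) (r : J -> R)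
    (N : J -> R -> T -> nat) : Prop :=
  (forall j, poisson_process (r j) (N j)) /\
  independent (fun j =>
    <<s \bigcup_(t in [set t : R | 0 <= t <= 1]) sigma_rv (N j t) >>).

End independence.

Record market (R : realType) (I J : finType) := Market {
  edge : I -> J -> bool;
  cap : I -> nat;
  rate : J -> R;
  groups : {set {set J}};
  cap_gt0 : forall i, (0 < cap i)%N;
  rate_gt0 : forall j, 0 < rate j;
  groups_cover : finset.cover groups = [set: J]%SET }.

Section market.
Context (R : realType) (I J : finType) (M : market R I J).

(* The default value of the iterated minimum is the maximum, so it does not
   affect the result when [I] is nonempty. *)
Definition min_cap : nat :=
  \big[minn/(\max_(i : I) cap M i)%N]_(i : I) cap M i.

(* Only the entries [x i j] with [edge M i j] matter. *)
Definition lp_feasible (x : I -> J -> R) (s : R) : Prop :=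
  [/\ forall i, \sum_(j | edge M i j) x i j <= (cap M i)%:R,
      forall G, G \in groups M ->
        s * \sum_(j in G) rate M j <=
        \sum_(j in G) \sum_(i | edge M i j) x i j,
      forall j, \sum_(i | edge M i j) x i j <= rate M j,
      0 <= s
    & forall i j, edge M i j -> 0 <= x i j].

Definition lp_optimal (x : I -> J -> R) (s : R) : Prop :=
  lp_feasible x s /\ forall x' s', lp_feasible x' s' -> s' <= s.

(* [(j, k)] is the [k]-th arriving agent of type [j], counting from 0. *)
Definition agent : Type := (J * nat)%type.

(* [a j t] is the number of arrivals of type [j] during [0, t]. *)
Definition realization : Type := J -> R -> nat.

Definition arrival_time (a : realization) (v : agent) : R :=
  inf [set t : R | 0 <= t <= 1 /\ (v.2 < a v.1 t)%N].

(* The arriving agents in order of arrival.  The sort is stable, so simultaneous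
   arrivals (a null event for Poisson processes) are ordered by the enumeration
   of [J]. *)
Definition arrival_seq (a : realization) : seq agent :=
  sort (fun u v => arrival_time a u <= arrival_time a v)
    [seq (j, k) | j <- enum J, k <- iota 0 (a j 1)].

(* The pairs (offline agent, served online agent). *)
Definition matching : Type := seq (I * (J * nat)).

Definition load (y : matching) (i : I) : nat := count (fun p => p.1 == i) y.

Definition served (y : matching) (j : J) : nat :=
  count (fun p => p.2.1 == j) y.

Definition valid_matching (a : realization) (y : matching) : Prop :=
  [/\ uniq (unzip2 y),
      forall i v, (i, v) \in y -> edge M i v.1 /\ (v.2 < a v.1 1%R)%N
    & forall i, (load y i <= cap M i)%N].

(* [pick v] is the offline agent sampled when [v] arrives, [None] if none. *)
Definition samp_step (pick : agent -> option I) (y : matching) (v : agent) :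
    matching :=
  if pick v is Some i then
    if (load y i < cap M i)%N then (i, v) :: y else y
  else y.

Definition samp (a : realization) (pick : agent -> option I) : matching :=
  foldl (samp_step pick) [::] (arrival_seq a).

Record samp_picks d (U : measurableType d) (Q : probability U R)
    (x : I -> J -> R) (pick : U -> agent -> option I) : Prop := SampPicks {
  picks_measurable : forall v o, measurable [set u | pick u v = o];
  picks_edge : forall u v i, pick u v = Some i -> edge M i v.1;
  picks_law : forall v i, edge M i v.1 ->
    Q [set u | pick u v = Some i] = (x i v.1 / rate M v.1)%:E;
  picks_law_None : forall v,
    Q [set u | pick u v = None] =
      (1 - \sum_(i | edge M i v.1) x i v.1 / rate M v.1)%:E;
  picks_indep : independent Q (fun v => sigma_rv (pick ^~ v)) }.

Section fairness.
Context d (T : measurableType d) (P : probability T R) (N : J -> R -> T -> nat).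

Definition realized (w : T) : realization :=
  fun j t => if 0 <= t <= 1 then N j t w else 0%N.

(* A randomized algorithm is a function [A] of the realized arrivals and of a
   seed drawn from [Q]; the product measure makes the seed independent of the
   arrivals.  The empty minimum is [+oo], and 0 / 0 = 0 in [\bar R]. *)
Definition fairness d' (U : measurableType d') (Q : probability U R)
    (A : realization -> U -> matching) : \bar R :=
  (\big[mine/+oo]_(G in groups M)
     ('E_(P \x Q)[fun z => (\sum_(j in G) served (A (realized z.1) z.2) j)%N%:R]
      / (\sum_(j in G) rate M j)%R%:E))%E.

(* [A] may use the whole realization to match any agent. *)
Definition clairvoyant d' (U : measurableType d')
    (A : realization -> U -> matching) : Prop :=
  (forall w u, valid_matching (realized w) (A (realized w) u)) /\
  (forall y, measurable [set z : T * U | A (realized z.1) z.2 = y]).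

Definition clairvoyant_opt : \bar R :=
  ereal_sup [set f : \bar R |
    exists (d' : measure_display) (U : measurableType d')
           (Q : probability U R) (A : realization -> U -> matching),
      clairvoyant A /\ f = fairness Q A].

End fairness.
End market.

Definition samp_ratio (R : realType) (b : nat) : R :=
  1 - expR (- b%:R) * (b%:R ^+ b / b`!%:R).

(* Main.v *)
(* The clairvoyant optimum is at most the LP value, since the expected numbers
   of matches along the edges of any clairvoyant algorithm form a feasible
   point.

   Under SAMP, agents requesting [i] arrive as a Poisson process of rate
   [mu = \sum_j x i j <= cap i], so an agent finds [i] free at time [t] with
   probability [F (mu * t)], where [F a] is the probability that a Poisson
   variable of mean [a] is less than [cap i].  Hence [i] serves at least
   [x i j * \int_0^1 F (mu * t) dt] agents of type [j] on average, and since [F]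
   decreases, [mu] may be replaced by [cap i], where the integral is exactly
   [samp_ratio (cap i)].

   The integral is reached through Riemann sums.  Cut [0, 1] into [n] intervals
   and count only the agents that are alone in their interval: such an agent
   is served as soon as it requests [i] and fewer than [cap i] requests for [i]
   precede its interval, an event whose probability is explicit by
   independence of increments. *)
Require Import Defs.
From mathcomp Require Import measurable_realfun ring lra.

Set Implicit Arguments.
Unset Strict Implicit.
Unset Printing Implicit Defensive.

Local Open Scope classical_set_scope.
Local Open Scope ring_scope.

(** * Poisson tails and the ratio *)

Section poisson_tail.
Variable R : realType.
Implicit Types (a x y : R) (c k n : nat).

Definition pois a k : R := expR (- a) * (a ^+ k / k`!%:R).
Definition pois_cdf c a : R := \sum_(k < c) pois a k.

(* The mean of [min (X, c)] for [X] Poisson of mean [a], written as a sum of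
   tails: it is an antiderivative of [pois_cdf c]. *)
Definition pois_min c a : R := \sum_(k < c) (1 - pois_cdf k.+1 a).

Lemma pois_ge0 a k : 0 <= a -> 0 <= pois a k.
Proof.
by move=> a0; rewrite mulr_ge0 ?expR_ge0// divr_ge0 ?exprn_ge0.
Qed.

Lemma pois0 k : pois 0 k = (k == 0)%:R.
Proof.
rewrite /pois oppr0 expR0 mul1r expr0n.
by case: k => [|k] /=; rewrite ?divr1 ?mul0r.
Qed.

Lemma pois_cdf_ge0 c a : 0 <= a -> 0 <= pois_cdf c a.
Proof. by move=> a0; apply: sumr_ge0 => k _; exact: pois_ge0. Qed.

Lemma pois_cdfS c a : pois_cdf c.+1 a = pois_cdf c a + pois a c.
Proof. by rewrite /pois_cdf big_ord_recr. Qed.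

Lemma pois_minS c a : pois_min c.+1 a = pois_min c a + (1 - pois_cdf c.+1 a).
Proof. by rewrite /pois_min big_ord_recr. Qed.

Lemma poisS a k : k.+1%:R * pois a k.+1 = a * pois a k.
Proof.
rewrite /pois factS natrM exprS.
have k0 : k`!%:R != 0 :> R by rewrite pnatr_eq0 -lt0n fact_gt0.
have k1 : k%:R + 1 != 0 :> R by rewrite natr1 pnatr_eq0.
by rewrite -natr1; field; rewrite k0.
Qed.

Lemma is_derive_pois0 a : is_derive a 1 (pois ^~ 0%N) (- pois a 0).
Proof.
have -> : pois ^~ 0%N = (fun x => expR (- x)).
  by apply/funext => x; rewrite /pois expr0 divr1 mulr1.
apply: is_derive_eq; rewrite /pois expr0 divr1; ring.
Qed.

Lemma is_derive_poisS a k :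
  is_derive a 1 (pois ^~ k.+1) (pois a k - pois a k.+1).
Proof.
have -> : pois ^~ k.+1 =
    k.+1`!%:R^-1 \*: ((fun x => expR (- x)) * (fun x => x ^+ k.+1)).
  by apply/funext => x; rewrite /pois mulrA mulrC.
have h0 : is_derive a 1 (fun x => expR (- x)) (- expR (- a)).
  by apply: is_derive_eq; ring.
have h1 : is_derive a 1 (fun x : R => x ^+ k.+1) (k.+1%:R * a ^+ k).
  have -> : (fun x : R => x ^+ k.+1) = id ^+ k.+1.
    by apply/funext => x; rewrite exprfctE.
  have := @is_deriveX R R id k.+1 a 1 1 (is_derive_id _ _).
  by rewrite /GRing.scale/= mulr1.
apply: is_derive_eq.
rewrite /GRing.scale/= /pois factS natrM exprS.
have k0 : k`!%:R != 0 :> R by rewrite pnatr_eq0 -lt0n fact_gt0.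
have k1 : k%:R + 1 != 0 :> R by rewrite natr1 pnatr_eq0.
rewrite -natr1.
by field; rewrite k0.
Qed.

(** The derivatives [pois a k - pois a k.+1] of the terms telescope. *)
Lemma is_derive_pois_cdf a c : is_derive a 1 (pois_cdf c.+1) (- pois a c).
Proof.
elim: c => [|c IH].
  have -> : pois_cdf 1 = pois ^~ 0%N.
    by apply/funext => x; rewrite /pois_cdf big_ord1.
  exact: is_derive_pois0.
have -> : pois_cdf c.+2 = pois_cdf c.+1 + pois ^~ c.+1.
  by apply/funext => x; rewrite pois_cdfS.
have -> : - pois a c.+1 = - pois a c + (pois a c - pois a c.+1).
  by rewrite addKr.
apply: is_deriveD; exact: is_derive_poisS.
Qed.

(** Each tail [1 - pois_cdf k.+1] has derivative [pois a k], and these add up to the distribution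
    function. *)
Lemma is_derive_pois_min a c : is_derive a 1 (pois_min c) (pois_cdf c a).
Proof.
elim: c => [|c IH].
  have -> : pois_min 0 = cst 0 by apply/funext => x; rewrite /pois_min big_ord0.
  by rewrite /pois_cdf big_ord0; exact: is_derive_cst.
have -> : pois_min c.+1 = pois_min c + (cst 1 - pois_cdf c.+1).
  by apply/funext => x; rewrite pois_minS.
have -> : pois_cdf c.+1 a = pois_cdf c a + (0 - - pois a c).
  by rewrite pois_cdfS sub0r opprK.
apply: is_deriveD; apply: is_deriveB; exact: is_derive_pois_cdf.
Qed.

Lemma is_derive_continuous (f : R -> R) (df : R -> R) :
  (forall x, is_derive x 1 f (df x)) -> continuous f.
Proof.
move=> h x; apply: differentiable_continuous; apply/derivable1_diffP.
by case: (h x).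
Qed.

Lemma pois_cdf_anti c x y : 0 <= x -> x <= y -> pois_cdf c y <= pois_cdf c x.
Proof.
case: c => [|c] x0 xy; first by rewrite /pois_cdf !big_ord0.
have h z := is_derive_pois_cdf z c.
apply: (@ler0_derive1_le_cc R _ 0 y) => //.
- move=> z; rewrite in_itv/= => /andP[/ltW z0 _].
  by rewrite derive1E; case: (h z) => _ ->; rewrite oppr_le0 pois_ge0.
- apply: continuous_subspaceT => z.
  exact: (is_derive_continuous h).
- by rewrite in_itv/= lexx (le_trans x0).
- by rewrite in_itv/= x0.
Qed.

(** Concavity of [pois_min c]: by the mean value theorem the slope of a chord is a value of the
    antitone derivative [pois_cdf c], hence at most its value at the left end. *)
Lemma pois_min_chord c x y : 0 <= x -> x <= y ->
  pois_min c y - pois_min c x <= (y - x) * pois_cdf c x.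
Proof.
move=> x0; rewrite le_eqVlt => /predU1P[->|xy]; first by rewrite !subrr mul0r.
have h z := is_derive_pois_min z c.
have hc : {within `[x, y], continuous (pois_min c)}.
  by apply: continuous_subspaceT => z; exact: (is_derive_continuous h).
have [z zxy ->] := @MVT R (pois_min c) (pois_cdf c) x y xy (fun z _ => h z) hc.
rewrite mulrC ler_wpM2l ?subr_ge0 ?(ltW xy)// pois_cdf_anti//.
by move: zxy; rewrite in_itv/= => /andP[/ltW].
Qed.

(** In the mean of [min (X, c.+1)], the values above [c] contribute the first term; on the others
    [poisS] turns [k * pois a k] into [a * pois a k.-1], which sums to the second. *)
Lemma pois_minE c a :
  pois_min c.+1 a = c.+1%:R * (1 - pois_cdf c.+1 a) + a * pois_cdf c a.
Proof.
elim: c => [|c IH].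
  by rewrite /pois_min big_ord1 {3}/pois_cdf big_ord0; ring.
rewrite pois_minS IH !pois_cdfS -[c.+2%:R]natr1.
have := poisS a c.
move: (pois a c.+1) (pois a c) (pois_cdf c a) c.+1%:R => p q F m h.
by lra.
Qed.

(** At the integer mean [c.+1] the distribution functions in [pois_minE] cancel up to [pois c.+1 c],
    which equals [pois c.+1 c.+1] because a Poisson law of integer mean has two adjacent modes. *)
Lemma pois_min_nat c : pois_min c c%:R = c%:R * samp_ratio R c.
Proof.
case: c => [|c]; first by rewrite /pois_min big_ord0 mul0r.
rewrite pois_minE pois_cdfS -mulrDr; congr (_ * _).
have := poisS c.+1%:R c => /(mulfI _) <-; last by rewrite pnatr_eq0.
by rewrite /samp_ratio /pois; ring.
Qed.

Lemma pois_min0 c : pois_min c 0 = 0.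
Proof.
rewrite /pois_min big1// => k _; rewrite /pois_cdf big_ord_recl pois0/=.
by rewrite big1 ?addr0 ?subrr// => l _; rewrite pois0.
Qed.

(** A left Riemann sum of a decreasing function exceeds its integral: [pois_min c] telescopes along
    the points [c * m / n], and [pois_min_chord] bounds each increment. Lowering the rate from [c]
    to [a] only increases [pois_cdf c]. *)
Lemma samp_ratio_riemann c n a : (0 < c)%N -> (0 < n)%N -> 0 <= a <= c%:R ->
  samp_ratio R c <= \sum_(m < n) n%:R^-1 * pois_cdf c (a * (m%:R / n%:R)).
Proof.
move=> c0 n0 /andP[a0 ac].
have c0' : 0 < c%:R :> R by rewrite ltr0n.
have n0' : 0 < n%:R :> R by rewrite ltr0n.
pose u (m : nat) : R := pois_min c (c%:R * (m%:R / n%:R)).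
rewrite -(ler_pM2l c0') -pois_min_nat.
have -> : pois_min c c%:R = \sum_(m < n) (u m.+1 - u m).
  rewrite -(big_mkord xpredT (fun m => u m.+1 - u m)) telescope_sumr//.
  by rewrite /u mul0r mulr0 pois_min0 subr0 divff ?mulr1// gt_eqF.
rewrite mulr_sumr; apply: ler_sum => m _.
have m0 : 0 <= m%:R / n%:R :> R by rewrite divr_ge0.
apply: (le_trans (pois_min_chord _ _ _)).
- by rewrite mulr_ge0.
- by rewrite ler_wpM2l// ler_wpM2r ?invr_ge0// ler_nat.
have -> : c%:R * (m.+1%:R / n%:R) - c%:R * (m%:R / n%:R) = c%:R * n%:R^-1 :> R.
  by rewrite -natr1; ring.
rewrite -mulrA ler_wpM2l// ler_wpM2l ?invr_ge0// pois_cdf_anti//.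
- by rewrite mulr_ge0.
- by rewrite ler_wpM2r.
Qed.

Lemma pois_cdf_le1 c a : 0 <= a -> pois_cdf c a <= 1.
Proof.
move=> a0; apply: (le_trans (pois_cdf_anti c (lexx 0) a0)).
case: c => [|c]; first by rewrite /pois_cdf big_ord0.
rewrite /pois_cdf big_ord_recl pois0/= big1 ?addr0// => k _.
by rewrite pois0.
Qed.

(** * Monotonicity and limit of the ratio *)

Lemma samp_ratioE n : samp_ratio R n = 1 - pois n%:R n.
Proof. by []. Qed.

Lemma samp_ratio_ge0 n : 0 <= samp_ratio R n.
Proof.
rewrite samp_ratioE subr_ge0 (le_trans _ (@pois_cdf_le1 n.+1 n%:R _))//.
by rewrite pois_cdfS lerDr pois_cdf_ge0.
Qed.

(** Since [pois n.+1 n.+1 = pois n.+1 n], the quotient of the two sides is [(1 + 1/n)^n / e], which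
    is below 1 because [1 + 1/n < e^(1/n)]. *)
Lemma pois_diag_decr n : (0 < n)%N -> pois n.+1%:R n.+1 < pois n%:R n.
Proof.
move=> n0; have n0' : 0 < n%:R :> R by rewrite ltr0n.
have -> : pois n.+1%:R n.+1 = pois n.+1%:R n.
  by apply: (mulfI _ (poisS _ n)); rewrite pnatr_eq0.
rewrite /pois -natr1 opprD expRD -mulrA ltr_pM2l ?expR_gt0// mulrA.
rewrite ltr_pM2r ?invr_gt0 ?ltr0n ?fact_gt0// expRN mulrC.
rewrite ltr_pdivrMr ?expR_gt0//.
have -> : n%:R + 1 = n%:R * (1 + n%:R^-1) :> R by field; rewrite gt_eqF.
rewrite exprMn ltr_pM2l ?exprn_gt0//.
have -> : expR 1 = expR n%:R^-1 ^+ n :> R.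
  by rewrite -expRM_natl mulfV// gt_eqF.
rewrite ltrXn2r ?gtn_eqF ?expR_gt1Dx ?addr_ge0 ?invr_ge0//.
by rewrite invr_eq0 gt_eqF.
Qed.

Lemma samp_ratio_lt m n : (0 < m)%N -> (m < n)%N ->
  samp_ratio R m < samp_ratio R n.
Proof.
move=> m0; elim: n => [//|n IH]; rewrite ltnS leq_eqVlt => /predU1P[<-|mn].
  by rewrite !samp_ratioE ltrD2l ltrN2 pois_diag_decr.
apply: (lt_trans (IH mn)); rewrite !samp_ratioE ltrD2l ltrN2 pois_diag_decr//.
exact: leq_ltn_trans mn.
Qed.

Lemma samp_ratio_le m n : (0 < m)%N -> (m <= n)%N ->
  samp_ratio R m <= samp_ratio R n.
Proof.
move=> m0; rewrite leq_eqVlt => /predU1P[->//|mn].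
exact/ltW/samp_ratio_lt.
Qed.

(** Going down from the diagonal, the successive factors are [1 - i/n] for [i < k], and their
    product is at least [1 - k^2/n]. *)
Lemma pois_below_diag n k : (k <= n)%N -> (0 < n)%N ->
  pois n%:R n * (1 - k%:R ^+ 2 / n%:R) <= pois n%:R (n - k).
Proof.
move=> + n0; have n0' : 0 < n%:R :> R by rewrite ltr0n.
elim: k => [_|k IH kn]; first by rewrite expr0n/= mul0r subr0 mulr1 subn0.
have := IH (ltnW kn); rewrite -(subnSK kn) => {}IH.
have E : pois n%:R (n - k.+1) = pois n%:R (n - k.+1).+1 * (1 - k%:R / n%:R).
  apply: (mulfI (x := n%:R)); first by rewrite gt_eqF.
  rewrite -poisS subnSK// natrB 1?ltnW//; by field; rewrite gt_eqF.
rewrite E; apply: (@le_trans _ _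
  (pois n%:R n * (1 - k%:R ^+ 2 / n%:R) * (1 - k%:R / n%:R))).
  rewrite -mulrA ler_wpM2l ?pois_ge0// -natr1.
  have u0 : 0 <= k%:R / n%:R :> R by rewrite divr_ge0.
  have v0 : 0 <= k%:R ^+ 2 / n%:R * (k%:R / n%:R) :> R.
    by rewrite mulr_ge0// divr_ge0// exprn_ge0.
  have w0 : 0 <= n%:R^-1 :> R by rewrite invr_ge0.
  have -> : (k%:R + 1) ^+ 2 / n%:R =
    k%:R ^+ 2 / n%:R + 2 * (k%:R / n%:R) + n%:R^-1 :> R by ring.
  by rewrite mulrBr mulr1 mulrBl mul1r; lra.
rewrite ler_wpM2r// subr_ge0 ler_pdivrMr// mul1r ler_nat.
exact: ltnW.
Qed.

(* The [K] probabilities just below the diagonal are at least half the diagonal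
   one, and they add up to at most 1. *)
Lemma pois_diag_le K n : (0 < K)%N -> (2 * K ^ 2 <= n)%N ->
  pois n%:R n <= 2 / K%:R.
Proof.
move=> K0 Kn; have n0 : (0 < n)%N.
  by apply: leq_trans Kn; rewrite muln_gt0 expn_gt0 K0.
have K0' : 0 < K%:R :> R by rewrite ltr0n.
have n0' : 0 < n%:R :> R by rewrite ltr0n.
have Kn1 : (K <= n)%N.
  by apply: leq_trans Kn; rewrite -mulnn mulnA leq_pmull// muln_gt0.
rewrite ler_pdivlMr//.
have h : \sum_(k < K) pois n%:R (n - k) <= 1.
  apply: le_trans (@pois_cdf_le1 n.+1 n%:R _) => //.
  have -> : pois_cdf n.+1 n%:R = \sum_(k < n.+1) pois n%:R (n - k).
    by rewrite /pois_cdf (reindex_inj rev_ord_inj); apply: eq_bigr => k _.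
  rewrite (big_ord_widen n.+1 (fun k => pois n%:R (n - k))) ?(leqW Kn1)//.
  rewrite big_mkcond; apply: ler_sum => k _; case: ifP => // _.
  by rewrite pois_ge0.
have : \sum_(k < K) (pois n%:R n / 2) <= 1.
  apply: le_trans h; apply: ler_sum => k _.
  apply: le_trans (@pois_below_diag n k _ n0); last exact: leq_trans (ltnW (ltn_ord k)) Kn1.
  rewrite ler_wpM2l ?pois_ge0//.
  have : k%:R ^+ 2 / n%:R <= 2^-1 :> R.
    rewrite ler_pdivrMr// mulrC ler_pdivlMr// mulrC -natrX -natrM ler_nat.
    by apply: leq_trans Kn; rewrite leq_mul2l/= leq_exp2r// ltnW.
  lra.
rewrite sumr_const card_ord -[_ *+ _]mulr_natr; lra.
Qed.

Lemma samp_ratio_cvg : samp_ratio R n @[n --> \oo] --> (1 : R).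
Proof.
rewrite -[X in _ --> X]subr0; apply: cvgB; first exact: cvg_cst.
apply/cvgr0Pnorm_le => e e0.
(* [K] exceeds [2 / e], so the bound [2 / K] of [pois_diag_le] falls below [e]. *)
pose K := (Num.truncn (2 / e)).+1.
near=> n.
rewrite ger0_norm; last exact: (@pois_ge0 n%:R n).
apply: (@le_trans _ _ (2 / K%:R)).
  apply: pois_diag_le => //; near: n; exact: nbhs_infty_ge.
rewrite ler_pdivrMr ?ltr0n// mulrC -ler_pdivrMr//.
by apply/ltW/truncnS_gt.
Unshelve. all: by end_near.
Qed.

End poisson_tail.

(** * Poisson thinning *)

Section thinning.
Variable R : realType.
Implicit Types (a b p : R) (k l n K : nat).

(* Generating function of a Bernoulli trial: the law of a number of successes is
   read off the coefficients of a product of these. *)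
Definition bern_gf p : {poly R} := (1 - p)%:P + p *: 'X.

Lemma coef_bern_gfX p k l :
  (bern_gf p ^+ k)`_l = (p ^+ l * (1 - p) ^+ (k - l)) *+ 'C(k, l).
Proof.
rewrite exprDn coef_sum.
under eq_bigr => i _.
  rewrite coefMn -polyC_exp coefCM exprZn coefZ coefXn.
  over.
case: (ltnP k l) => kl.
  rewrite bin_small// mulr0n big1// => i _.
  by rewrite gtn_eqF ?mulr0 ?mul0rn// (leq_trans (ltn_ord i)).
rewrite (bigD1 (Ordinal (kl : l < k.+1)%N))//= eqxx mulr1 mulrC big1 ?addr0// => i il.
rewrite [l == _]eq_sym.
case: eqP => [e|_]; last by rewrite !mulr0 mul0rn.
by case/eqP: il; apply/val_inj.
Qed.

(** The binomial expansion of [(a + b) ^+ l], with the coefficients written in factorials. *)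
Lemma pois_conv a b l :
  \sum_(i < l.+1) pois a i * pois b (l - i) = pois (a + b) l.
Proof.
rewrite /pois opprD expRD [a + b]addrC exprDn -mulrA mulr_suml !mulr_sumr.
apply: eq_bigr => -[i]; rewrite /= ltnS => il _.
have h : ('C(l, i))%:R = l`!%:R / (i`!%:R * (l - i)`!%:R) :> R.
  by rewrite -(bin_fact il) natrM natrM mulfK// mulf_neq0//
    pnatr_eq0 -lt0n fact_gt0.
rewrite -[_ *+ 'C(_, _)]mulr_natr h.
have k0 m : m`!%:R != 0 :> R by rewrite pnatr_eq0 -lt0n fact_gt0.
by field; rewrite !k0.
Qed.

(* The series converges coefficientwise only: truncations in [K] keep the
   generating functions polynomial. *)
Lemma pois_thinning_cvg a p l :
  (\sum_(k < K) pois a k *: bern_gf p ^+ k)`_l @[K --> \oo] --> pois (a * p) l.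
Proof.
(* The coefficient of degree [l] vanishes for [k < l]. Shifted by [l], the index counts failures,
   and the sum is a partial sum of the exponential series at [a * (1 - p)]. *)
rewrite -(cvg_shiftn l).
rewrite [X in X @ _ --> _](_ : _ = (fun K => expR (- a) * ((a * p) ^+ l / l`!%:R) *
    series (exp_coeff (a * (1 - p))) K)); last first.
  apply/funext => K; rewrite /= coef_sum.
  rewrite -(big_mkord xpredT (fun k => (pois a k *: bern_gf p ^+ k)`_l)).
  rewrite (@big_cat_nat _ _ _ l)//= ?leq_addl//.
  rewrite big_nat big1 ?add0r; last first.
    by move=> k /andP[_ kl]; rewrite coefZ coef_bern_gfX bin_small// mulr0n mulr0.
  rewrite -[X in \sum_(X <= _ < _) _](add0n l) big_addn addnK.
  rewrite /series/= mulr_sumr; apply: eq_bigr => k _.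
  rewrite coefZ coef_bern_gfX addnK /pois /exp_coeff/=.
  have h : ('C(k + l, l))%:R = (k + l)`!%:R / (l`!%:R * k`!%:R) :> R.
    by rewrite -(bin_fact (leq_addl k l)) addnK !natrM mulfK// mulf_neq0//
      pnatr_eq0 -lt0n fact_gt0.
  have k0 m : m`!%:R != 0 :> R by rewrite pnatr_eq0 -lt0n fact_gt0.
  rewrite -[_ *+ 'C(_, _)]mulr_natr h exprD !exprMn.
  by field; rewrite !k0.
have -> : pois (a * p) l =
    expR (- a) * ((a * p) ^+ l / l`!%:R) * expR (a * (1 - p)).
  rewrite /pois [RHS]mulrAC -expRD; congr (expR _ * _); ring.
apply: cvgM; first exact: cvg_cst.
exact: is_cvg_series_exp_coeff.
Qed.

(** Coefficients of a product are finite convolutions, so limits pass through them, and [pois_conv]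
    evaluates the result. *)
Lemma coef_prod_pois_cvg (J : Type) (s : seq J) (S : J -> nat -> {poly R})
    (a : J -> R) :
  (forall j l, (S j K)`_l @[K --> \oo] --> pois (a j) l) ->
  forall l, (\prod_(j <- s) S j K)`_l @[K --> \oo] --> pois (\sum_(j <- s) a j) l.
Proof.
move=> h; elim: s => [|j s IH] l.
  rewrite big_nil pois0 -coef1; under eq_fun do rewrite big_nil.
  exact: cvg_cst.
rewrite big_cons -pois_conv; under eq_fun do rewrite big_cons coefM.
apply: cvg_big => [|i _]; first exact: add_continuous.
exact: cvgM.
Qed.

(** The weights are the law of independent arrival counts, truncated below [K]; the inner sum is the
    probability of fewer than [c] requests given these counts. Distributivity turns the mixture into
    a product of one thinned series per type. *)
Lemma pois_mixture_cvg (J : finType) (a p : J -> R) c :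
  \sum_(f : {ffun J -> 'I_K}) (\prod_j pois (a j) (f j)) *
     \sum_(l < c) (\prod_j bern_gf (p j) ^+ f j)`_l @[K --> \oo] -->
  pois_cdf c (\sum_j a j * p j).
Proof.
rewrite [X in X @ _ --> _](_ : _ = (fun K => \sum_(l < c)
   (\prod_j \sum_(k < K) pois (a j) k *: bern_gf (p j) ^+ k)`_l)); last first.
  apply/funext => K; rewrite /=; under eq_bigr do rewrite mulr_sumr.
  rewrite exchange_big/=; apply: eq_bigr => l _.
  rewrite bigA_distr_bigA/= coef_sum; apply: eq_bigr => f _.
  by rewrite [in RHS]scaler_prod coefZ.
rewrite /pois_cdf; apply: cvg_big => [|l _]; first exact: add_continuous.
by apply: coef_prod_pois_cvg => j m; exact: pois_thinning_cvg.
Qed.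

End thinning.

(** * Independent trials *)

Section integration.
Context d (T : measurableType d) (R : realType) (mu : {measure set T -> \bar R}).
Local Open Scope ereal_scope.

(* Unlike [ge0_le_integral], no measurability: the integral of a nonnegative
   function is a supremum over the simple functions below it. *)
Lemma ge0_le_integralT (f g : T -> \bar R) :
  (forall x, 0 <= f x) -> (forall x, f x <= g x) ->
  \int[mu]_x f x <= \int[mu]_x g x.
Proof.
move=> f0 fg.
have g0 x : 0 <= g x by apply: le_trans (fg x).
rewrite !ge0_integralTE//; apply: le_ereal_sup => _ [h/= hf <-].
by exists h => //= x; apply: le_trans (fg x).
Qed.

(** Measurability is asked of the events only: [f] will be the number of agents served by SAMP,
    bounded below by indicators. *)
Lemma sum_measure_le_integral (K : finType) (D : pred K) (A : K -> set T)
    (f : T -> \bar R) :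
  (forall k, D k -> measurable (A k)) ->
  (forall x, \sum_(k | D k) (\1_(A k) x)%:E <= f x) ->
  \sum_(k | D k) mu (A k) <= \int[mu]_x f x.
Proof.
move=> mA Af.
have -> : \sum_(k | D k) mu (A k) =
    \int[mu]_x \sum_(k | D k) (\1_(A k) x)%:E.
  under eq_integral do rewrite big_mkcond.
  rewrite (@ge0_integral_sum _ _ _ mu setT _ _
    (fun k x => if D k then (\1_(A k) x)%:E else 0))//.
  - rewrite big_mkcond; apply: eq_bigr => k _; case: ifPn => Dk.
      by rewrite (integral_indic mu measurableT) ?setIT//; exact: mA.
    by apply/esym; exact: integral0_eq.
  - move=> k; case: (boolP (D k)) => Dk; last exact: measurable_cst.
    by apply/measurable_EFinP; apply: measurable_indic; exact: mA.
  - by move=> k x _; case: ifP => // _; rewrite lee_fin.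
apply: ge0_le_integralT => // x.
by apply: sume_ge0 => k _; rewrite lee_fin.
Qed.

End integration.

Section independent_trials.
Context d (U : measurableType d) (R : realType) (Q : probability U R).
Context (K : eqType) (S : K -> set (set U)).
Hypothesis indepS : independent Q S.
Hypothesis measS : forall v A, S v A -> measurable A.
Variables (e : U -> K -> bool) (p : K -> R).
Hypothesis S_e : forall v, S v [set u | e u v].
Hypothesis S_ne : forall v, S v [set u | ~~ e u v].
Hypothesis Q_e : forall v, Q [set u | e u v] = (p v)%:E.

Lemma prob_not_e v : Q [set u | ~~ e u v] = (1 - p v)%:E.
Proof.
have -> : [set u | ~~ e u v] = ~` [set u | e u v].
  by apply/seteqP; split => u /=; [move=> /negP|move=> /negP].
by rewrite probability_setC ?Q_e//; exact: measS (S_e v).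
Qed.

Lemma measurable_count s l : measurable [set u | count (e u) s = l].
Proof.
elim: s l => [|v s IH] l.
  by case: (eqVneq 0%N l) => [<-|/eqP l0]; [rewrite [X in measurable X](_ : _ = setT)|
    rewrite [X in measurable X](_ : _ = set0)]; rewrite //=; apply/seteqP; split.
rewrite [X in measurable X](_ : _ =
  ([set u | e u v] `&` (if l is l'.+1 then [set u | count (e u) s = l'] else set0)) `|`
  ([set u | ~~ e u v] `&` [set u | count (e u) s = l])); last first.
  apply/seteqP; split => u /=; case: (e u v) => /=.
  - by case: l => [|l] // [] h; left.
  - by rewrite add0n; right.
  - by case: l => [|l] [[_ h]|[]//]; [case: h|rewrite add1n h].
  - by case=> -[].
apply: measurableU; apply: measurableI => //.
- exact: measS (S_e v).
- by case: l.
- exact: measS (S_ne v).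
Qed.

(* The events [A] on [t] strengthen the induction on [s]: each step moves one
   trial from [s] to [t]. *)
Lemma prob_count (s t : seq K) (A : K -> set U) (q : K -> R) (l : nat) :
  uniq (t ++ s) -> (forall v, v \in t -> S v (A v)) ->
  (forall v, v \in t -> Q (A v) = (q v)%:E) ->
  Q ((\bigcap_(v in [set` t]) A v) `&` [set u | count (e u) s = l]) =
  ((\prod_(v <- t) q v) * (\prod_(v <- s) bern_gf (p v))`_l)%:E.
Proof.
elim: s t A q l => [|v s IH] t A q l.
  rewrite cats0 => ut tS tq; rewrite big_nil coef1/=.
  have -> : [set u : U | 0%N = l] = if l == 0%N then setT else set0.
    by case: l => [|l] /=; apply/seteqP; split.
  case: eqP => _; rewrite ?setI0 ?measure0 ?mulr0//= setIT mulr1.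
  rewrite (indepS ut tS) -prodEFin.
  by apply: eq_big_seq => w wt; exact: tq.
move=> uts tS tq.
have vt : v \notin t.
  by move: uts; rewrite cat_uniq/= negb_or => /and3P[_ /andP[]].
have uvts : uniq ((v :: t) ++ s).
  move: uts; rewrite cat_uniq/= negb_or => /and3P[ut /andP[_ h] /andP[vs us]].
  by rewrite mem_cat negb_or vt vs cat_uniq ut h us.
(* The list [t] is extended by [v], with [B] the success or the failure of trial [v]. *)
pose A' (B : set U) w := if w == v then B else A w.
pose q' (r : R) w := if w == v then r else q w.
have tE B : \bigcap_(w in [set` v :: t]) A' B w =
    B `&` \bigcap_(w in [set` t]) A w.
  have h w : w \in t -> A' B w = A w.
    by move=> wt; rewrite /A'; case: eqP wt vt => // -> ->.
  apply/seteqP; split => u /=.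
    move=> hu; split; first by move: (hu v (mem_head _ _)); rewrite /A' eqxx.
    by move=> w wt; rewrite -h//; apply: hu => /=; rewrite inE wt orbT.
  case=> Bu hu w /=; rewrite inE => /predU1P[->|wt]; first by rewrite /A' eqxx.
  by rewrite h//; exact: hu.
have qE r : \prod_(w <- v :: t) q' r w = r * \prod_(w <- t) q w.
  rewrite big_cons /q' eqxx; congr (_ * _); apply: eq_big_seq => w wt.
  by case: eqP wt vt => // -> ->.
have step B r l' : S v B -> Q B = r%:E ->
    Q (B `&` (\bigcap_(w in [set` t]) A w) `&` [set u | count (e u) s = l']) =
    (r * (\prod_(w <- t) q w) * (\prod_(w <- s) bern_gf (p w))`_l')%:E.
  move=> SB QB; rewrite -tE -qE; apply: IH => // w; rewrite inE /A' /q'.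
    by case: eqP => [->//|_] /=; exact: tS.
  by case: eqP => [//|_] /=; exact: tq.
have mB : measurable (\bigcap_(w in [set` t]) A w).
  apply: fin_bigcap_measurable => [|w wt]; last exact/measS/tS.
  exact: finite_seq.
(* Success and failure of trial [v] match the two terms of [bern_gf (p v)]: the factor ['X] lowers
   the coefficient index by one, as a success lowers the remaining count. *)
rewrite [X in Q X](_ : _ =
  ([set u | e u v] `&` (\bigcap_(w in [set` t]) A w) `&`
     (if l is l'.+1 then [set u | count (e u) s = l'] else set0)) `|`
  ([set u | ~~ e u v] `&` (\bigcap_(w in [set` t]) A w) `&`
     [set u | count (e u) s = l])); last first.
  apply/seteqP; split => u /=.
    case=> hu; case: (boolP (e u v)) => euv /=.
      by case: l => [|l] // [] hl; left.
    by rewrite add0n; right.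
  case: (boolP (e u v)) => euv /=.
    by case: l => [|l] [[[_ hu] hl]|[[h _] _]] //; split => //; rewrite hl.
  by case=> [[[h _] _]|[[_ hu] hl]].
rewrite measureU; last first.
- by apply/seteqP; split => u //= -[[[/= euv _] _] [[/= /negP]]].
- apply: measurableI; last exact: measurable_count.
  by apply: measurableI => //; exact: measS (S_ne v).
- apply: measurableI; last by case: l => // l; exact: measurable_count.
  by apply: measurableI => //; exact: measS (S_e v).
rewrite [X in (_ + X)%E](step _ _ l (S_ne v) (prob_not_e v)).
rewrite big_cons; move: step; set G := \prod_(w <- s) _ => step.
rewrite /bern_gf [_ * G]mulrDl coefD coefCM -[_ *: 'X * G]scalerAl coefZ coefXM.
case: l => [|l] /=.
  by rewrite setI0 measure0 add0e mulr0 addr0; congr (_%:E); ring.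
rewrite [X in (X + _)%E](step _ _ l (S_e v) (Q_e v)) -EFinD; congr (_%:E); ring.
Qed.

Lemma prob_count_lt (s : seq K) (v : K) (A : set U) (q : R) (c : nat) :
  uniq (v :: s) -> S v A -> Q A = q%:E ->
  measurable (A `&` [set u | (count (e u) s < c)%N]) /\
  Q (A `&` [set u | (count (e u) s < c)%N]) =
  (q * \sum_(l < c) (\prod_(w <- s) bern_gf (p w))`_l)%:E.
Proof.
move=> uvs SA QA; have mA := measS SA.
elim: c => [|c [IHm IH]].
  rewrite [X in measurable X /\ Q X = _](_ : _ = set0); last first.
    by apply/seteqP; split => u //= -[].
  by rewrite measure0 big_ord0 mulr0.
have mc : measurable (A `&` [set u | count (e u) s = c]).
  by apply: measurableI => //; exact: measurable_count.
rewrite [X in measurable X /\ Q X = _](_ : _ =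
  (A `&` [set u | (count (e u) s < c)%N]) `|` (A `&` [set u | count (e u) s = c]));
  last first.
  apply/seteqP; split => u /=.
    by case=> Au; rewrite ltnS leq_eqVlt => /predU1P[->|]; [right|left].
  by case=> -[Au]; [move=> h; rewrite ltnS ltnW|move=> ->].
split; first exact: measurableU.
rewrite measureU//; last first.
  by apply/seteqP; split => u //= -[[_ h] [_ h']]; rewrite h' ltnn in h.
rewrite [X in (X + _)%E]IH big_ord_recr/= mulrDr EFinD; congr (_ + _)%E.
have := @prob_count s [:: v] (fun=> A) (fun=> q) c uvs.
rewrite big_seq1 => <-.
- congr (Q (_ `&` _)); apply/seteqP; split => u /=.
    by move=> Au w _.
  by move=> /(_ v (mem_head _ _)).
- by move=> w; rewrite inE => /eqP ->.
- by [].
Qed.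

End independent_trials.

(** * Arrival counts *)

Section poisson_counts.
Context d (T : measurableType d) (R : realType) (P : probability T R).

Section one_process.
Variables (r : R) (N : R -> T -> nat).
Hypotheses (r0 : 0 < r) (hN : poisson_process P r N).

Lemma poisson_process_measurable_eq t k : 0 <= t <= 1 ->
  measurable [set w | N t w = k].
Proof.
by move=> /(pp_measurable hN) /(_ measurableT [set k] I); rewrite setTI.
Qed.

Lemma poisson_process_law t k : 0 <= t <= 1 ->
  P [set w | N t w = k] = (pois (r * t) k)%:E.
Proof.
case/andP; rewrite le_eqVlt => /predU1P[<- _|t0 t1].
  rewrite mulr0 pois0; case: k => [|k] /=.
    rewrite (_ : [set w | _] = setT) ?probability_setT//.
    by apply/seteqP; split => w //= _; exact: (pp_zero hN).
  rewrite (_ : [set w | _] = set0) ?measure0//.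
  by apply/seteqP; split => w //=; rewrite (pp_zero hN).
have := pp_law hN (lexx 0) t0 t1 k.
under eq_set do rewrite (pp_zero hN) subn0.
move=> ->; rewrite subr0 /poisson_pmf mulr_gt0//; congr (_%:E).
by rewrite /pois mulrC.
Qed.

Lemma poisson_process_law2 s t a b : 0 <= s -> s < t -> t <= 1 ->
  P [set w | N s w = a /\ N t w = (a + b)%N] =
  (pois (r * s) a * pois (r * (t - s)) b)%:E.
Proof.
move=> s0 st t1; have s1 := le_trans (ltW st) t1.
(* The grid is 0, [s], [t], [t], and so on. As the process starts at 0, its first two increments are
   [N s] and [N t - N s]. *)
pose tau (m : nat) : R := if m is m'.+1 then (if m' is _.+1 then t else s) else 0.
pose A (m : nat) := if m is m'.+1 then [set w | (N t w - N s w)%N = b]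
  else [set w | N s w = a].
have tau_homo : {homo tau : m n / (m <= n)%N >-> m <= n}.
  by move=> [|[|m]] [|[|n]] //= _; rewrite ?(ltW st)// (le_trans s0)// ltW.
have tau01 m : 0 <= tau m <= 1.
  by case: m => [|[|m]] /=; rewrite ?lexx ?ler01 ?s0 ?s1 ?t1 ?(le_trans s0 (ltW st)).
have := pp_indep hN tau_homo tau01 (s := [:: 0%N; 1%N]) (A := A) isT.
have -> : \bigcap_(k in [set` [:: 0%N; 1%N]]) A k =
    [set w | N s w = a /\ N t w = (a + b)%N].
  apply/seteqP; split => w /=.
    move=> h; have /= h0 := h 0%N isT.
    have /= h1 := h 1%N isT; split => //.
    by rewrite -h0 -h1 subnKC// (pp_nondecreasing hN)// ltW.
  by move=> [h0 h1] k /=; rewrite !inE => /orP[] /eqP -> //=; rewrite h1 h0 addKn.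
rewrite big_cons big_seq1 /= => ->.
- rewrite poisson_process_law ?s0// (pp_law hN)// -EFinM; congr (_ * _)%:E.
  rewrite /poisson_pmf mulr_gt0 ?subr_gt0//.
  by rewrite /pois mulrC.
- move=> k; rewrite !inE => /orP[] /eqP -> /=.
    exists [set a] => //; rewrite setTI; apply/seteqP; split => w /=;
      by rewrite (pp_zero hN) subn0.
  by exists [set b] => //; rewrite setTI.
Qed.

(** Summing over the level sets of [N 1], [poisS] turns [k * pois r k] into [r * pois r k.-1], so
    every partial sum is at most [r]. *)
Lemma poisson_process_mean : (\int[P]_w (N 1 w)%:R%:E <= r%:E)%E.
Proof.
have m01 : 0 <= (1 : R) <= 1 by rewrite ler01 lexx.
pose F k := [set w | N 1 w = k].
have mF k : measurable (F k) by exact: poisson_process_measurable_eq.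
have UF : \bigcup_k F k = setT.
  by apply/seteqP; split => w // _; exists (N 1 w).
rewrite -UF ge0_integral_bigcup//=; last 2 first.
- rewrite UF; apply/measurable_EFinP.
  have : measurable_fun setT (fun k : nat => k%:R : R) by [].
  move=> h; exact: (measurableT_comp h (pp_measurable hN m01)).
- by apply/trivIsetP => i k _ _ ik; apply/seteqP; split => w //= [h1 h2];
    move: ik; rewrite -h1 -h2 eqxx.
have -> : (\sum_(0 <= k <oo) \int[P]_(x in F k) (N 1 x)%:R%:E)%E =
   (\sum_(0 <= k <oo) (k%:R * pois r k)%:E)%E.
  apply: eq_eseriesr => k _.
  rewrite (eq_integral (cst (k%:R%:E))); last by move=> w; rewrite inE => <-.
  by rewrite integral_cst// [X in (_ * X)%E](poisson_process_law k m01) mulr1 EFinM.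
apply: lime_le.
  by apply: is_cvg_nneseries => k _ _; rewrite lee_fin mulr_ge0// pois_ge0// ltW.
apply: nearW => n; rewrite sumEFin lee_fin.
case: n => [|n]; first by rewrite big_geq// ltW.
rewrite big_mkord big_ord_recl mul0r add0r.
under eq_bigr do rewrite lift0 poisS.
rewrite -mulr_sumr -[leRHS]mulr1 ler_wpM2l//; first exact: ltW.
by rewrite (@pois_cdf_le1 _ n)// ltW.
Qed.

End one_process.

(** When [b] is the indicator of one type, the event says that a single agent, of that type, arrives
    between [s] and [t], after [f] earlier ones. Independence across types reduces it to
    [poisson_process_law2]. *)
Lemma independent_poisson_single_arrival (J : finType) (r : J -> R)
    (N : J -> R -> T -> nat) (s t : R) (f b : J -> nat) :
  (forall j, 0 < r j) -> independent_poisson_processes P r N ->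
  0 <= s -> s < t -> t <= 1 ->
  let A := [set w | forall j, N j s w = f j /\ N j t w = (f j + b j)%N] in
  measurable A /\
  P A = ((\prod_j pois (r j * s) (f j)) * \prod_j pois (r j * (t - s)) (b j))%:E.
Proof.
move=> r0 [hN indN] s0 st t1.
have s01 : 0 <= s <= 1 by rewrite s0 (le_trans (ltW st)).
have t01 : 0 <= t <= 1 by rewrite t1 (le_trans s0 (ltW st)).
pose B j := [set w | N j s w = f j /\ N j t w = (f j + b j)%N].
have -> /= : [set w | forall j, N j s w = f j /\ N j t w = (f j + b j)%N] =
    \bigcap_(j in [set` enum J]) B j.
  apply/seteqP; split => w /= h j; first by move=> _; exact: h.
  by apply: h; rewrite /= mem_enum.
split.
  apply: fin_bigcap_measurable => [|j _]; first exact: finite_seq.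
  by apply: measurableI; apply: (poisson_process_measurable_eq (hN j)).
rewrite indN ?enum_uniq//; last first.
  move=> j _ /=; set G := \bigcup_(t in _) _.
  have mN u k : 0 <= u <= 1 -> <<s G >> [set w | N j u w = k].
    move=> u01; apply: sub_sigma_algebra; exists u => //.
    by exists [set k] => //; rewrite setTI.
  rewrite /B (_ : [set w | _] = [set w | N j s w = f j] `&`
    [set w | N j t w = (f j + b j)%N])//.
  exact: (@measurableI _ (g_sigma_algebraType G) _ _ (mN _ _ s01) (mN _ _ t01)).
rewrite big_enum/= -big_split/= -prodEFin; apply: eq_bigr => j _.
exact: (poisson_process_law2 (r0 j) (hN j)).
Qed.

Lemma prod_pois_delta (J : finType) (r : J -> R) (h : R) (j0 : J) :
  \prod_j pois (r j * h) (j == j0) =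
  r j0 * h * expR (- ((\sum_j r j) * h)).
Proof.
under eq_bigr do rewrite /pois.
rewrite big_split/= -expR_sum mulrC; congr (_ * expR _).
  rewrite (bigD1 j0)//= eqxx big1 ?mulr1 ?divr1//.
  by move=> j /negbTE ->; rewrite divr1.
by rewrite sumrN mulr_suml.
Qed.

End poisson_counts.

(** * Matchings produced by sampling *)

Section agents.
Variable J : finType.

Definition agents (f : J -> nat) : seq (J * nat) :=
  [seq (j, k) | j <- enum J, k <- iota 0 (f j)].

Lemma mem_agents f v : (v \in agents f) = (v.2 < f v.1)%N.
Proof.
case: v => j k /=; apply/allpairsPdep/idP => [[j' [k' [_]]]|kf].
  by rewrite mem_iota add0n => /andP[_ h] [-> ->].
by exists j, k; rewrite mem_enum mem_iota.
Qed.

Lemma agents_uniq f : uniq (agents f).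
Proof.
apply: allpairs_uniq_dep => [|j _|]; rewrite ?enum_uniq ?iota_uniq//.
by move=> [j k] [j' k'] _ _ /= [-> ->].
Qed.

Lemma prod_agents (A : comNzRingType) (f : J -> nat) (F : J -> A) :
  \prod_(v <- agents f) F v.1 = \prod_j F j ^+ f j.
Proof.
rewrite big_allpairs_dep/= big_enum/=; apply: eq_bigr => j _.
by rewrite big_const_seq count_predT size_iota iter_mulr_1.
Qed.

End agents.

Section sampled_matching.
Context (R : realType) (I J : finType) (M : market R I J).
Implicit Types (y : matching I J) (v : J * nat) (i : I) (j : J).

Definition serves y i j : nat := count (fun p => (p.1 == i) && (p.2.1 == j)) y.

Lemma served_sum y j : served y j = (\sum_i serves y i j)%N.
Proof.
elim: y => [|[i v] y IH]; first by rewrite big1.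
rewrite /= IH /serves/= big_split/=; congr addn.
by rewrite (bigD1 i)//= eqxx/= big1 ?addn0// => i' /negbTE; rewrite eq_sym => ->.
Qed.

Variable pick : J * nat -> option I.
Let step := samp_step M pick.
Let picked i v := pick v == Some i.

Lemma load_samp_le y s i :
  (load (foldl step y s) i <= load y i + count (picked i) s)%N.
Proof.
elim: s y => [|v s IH] y /=; first by rewrite addn0.
apply: (leq_trans (IH _)); rewrite addnA leq_add2r /step /samp_step /picked.
case: (pick v) => [i'|]; last by rewrite leq_addr.
case: ifP => _; last by rewrite leq_addr.
by rewrite /load/= addnC.
Qed.

Lemma mem_samp_step p y s : p \in y -> p \in foldl step y s.
Proof.
elim: s y => [|v s IH] y //= py; apply: IH; rewrite /step /samp_step.
by case: (pick v) => [i|//]; case: ifP => // _; rewrite inE py orbT.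
Qed.

(** The load of [i] is at most the number of requests made for it, whether or not they were granted,
    and a match once made is never undone. *)
Lemma mem_samp a s1 s2 v i : arrival_seq a = s1 ++ v :: s2 -> pick v = Some i ->
  (count (picked i) s1 < cap M i)%N -> (i, v) \in samp M a pick.
Proof.
move=> e pv lt_cap; rewrite /samp e foldl_cat /=; apply: mem_samp_step.
rewrite /samp_step pv ifT ?mem_head//.
exact: leq_ltn_trans (load_samp_le [::] s1 i) lt_cap.
Qed.

Variable a : realization R J.
Hypothesis a_mono : forall j s t, 0 <= s -> s <= t -> t <= 1 ->
  (a j s <= a j t)%N.
Hypothesis a_rc : forall j t, 0 <= t < 1 -> \forall u \near t^'+, a j u = a j t.

Lemma arrival_time_le v t : 0 <= t <= 1 -> (v.2 < a v.1 t)%N ->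
  arrival_time a v <= t.
Proof.
move=> t01 vt; apply: ge_inf; last by split.
by exists 0 => u [/andP[]].
Qed.

(** Right continuity freezes the count on some interval from [t] to [t + e], which keeps the infimum
    away from [t]. *)
Lemma arrival_time_gt v t : 0 <= t < 1 -> (a v.1 t <= v.2)%N ->
  (v.2 < a v.1 1%R)%N -> t < arrival_time a v.
Proof.
move=> /[dup] t01 /andP[t0 t1] tv v1.
have [e /= e0 he] := a_rc v.1 t01.
apply: (@lt_le_trans _ _ (t + e)); first by rewrite ltrDl.
apply: lb_le_inf; first by exists 1; rewrite /= ler01 lexx.
move=> s [/andP[s0 s1] vs]; rewrite leNgt; apply/negP => st.
have [ts|ts] := leP s t.
  have := a_mono v.1 s0 ts (ltW t1).
  by rewrite leqNgt (leq_ltn_trans tv vs).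
have := he s; rewrite /= ltr0_norm ?subr_lt0// opprB ltrBlDl => /(_ st ts) E.
by move: vs; rewrite E ltnNge tv.
Qed.

(* Right continuity is what excludes ties: an agent that has not arrived by time
   [t] is sorted strictly after one that has. *)
Lemma single_arrival_mem_samp s t i j : 0 <= s -> s < t -> t <= 1 ->
  (forall j', a j' t = (a j' s + (j' == j))%N) ->
  pick (j, a j s) = Some i ->
  (count (picked i) (agents (fun j' => a j' s)) < cap M i)%N ->
  (i, (j, a j s)) \in samp M a pick.
Proof.
move=> s0 st t1 a1 pv lt_cap; set v := (j, a j s).
have t0 : 0 <= t by apply: le_trans (ltW st).
have t01 : 0 <= t <= 1 by rewrite t0.
have vt : (v.2 < a v.1 t)%N by rewrite /v/= a1 eqxx addn1.
have vseq : v \in arrival_seq a.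
  rewrite mem_sort -/(agents _) mem_agents.
  exact: leq_trans vt (a_mono j t0 t1 (lexx 1)).
case/splitPr E: _ / vseq => [s1 s2].
apply: (mem_samp E pv); apply: leq_ltn_trans lt_cap.
have sorted_E : sorted (fun u v => arrival_time a u <= arrival_time a v)
    (s1 ++ v :: s2).
  by rewrite -E; apply: sort_sorted => x y; exact: le_total.
have uniq_E : uniq (s1 ++ v :: s2) by rewrite -E sort_uniq agents_uniq.
rewrite -!size_filter; apply: uniq_leq_size.
  by move: uniq_E; rewrite cat_uniq => /and3P[u1 _ _]; exact: filter_uniq.
move=> u; rewrite !mem_filter => /andP[-> us1]; rewrite mem_agents /=.
have uv : arrival_time a u <= arrival_time a v.
  move: sorted_E; rewrite sorted_pairwise; last by move=> x y z; exact: le_trans.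
  by rewrite pairwise_cat => /andP[/allrelP/(_ u v us1 (mem_head _ _))].
have u1 : (u.2 < a u.1 1%R)%N.
  have : u \in arrival_seq a by rewrite E mem_cat us1.
  by rewrite mem_sort -/(agents _) mem_agents.
have neq_uv : u != v.
  move: uniq_E; rewrite cat_uniq => /and3P[_ /hasPn/(_ v (mem_head _ _)) vs1 _].
  by apply: contraNneq vs1 => <-.
(* If [u] had not arrived by [s], then, not being [v], the only arrival between [s] and [t], it
   would not have arrived by [t] either and would come strictly after [v]. *)
rewrite ltnNge; apply/negP => su.
have tu : (a u.1 t <= u.2)%N.
  rewrite a1; case: eqP => [uj|_]; last by rewrite addn0.
  rewrite addn1 ltn_neqAle su andbT; apply: contraNneq neq_uv => h.
  by rewrite [u]surjective_pairing /v -h uj.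
(* Right continuity says nothing at time 1, but every agent has arrived by then. *)
have [t_eq1|t_lt1] := eqVneq t 1.
  by move: u1; rewrite -t_eq1 ltnNge tu.
have := arrival_time_gt (v := u) (t := t) _ tu u1.
rewrite t0 lt_neqAle t_lt1 t1 => /(_ isT); apply/negP; rewrite -leNgt.
exact: le_trans uv (arrival_time_le t01 vt).
Qed.

(** Each counted interval yields a match by [single_arrival_mem_samp], for a different agent each
    time. Summing over [f] makes the counts at [tau m] explicit, so that every indicator has a
    computable probability. *)
Lemma serves_samp_ge (tau : nat -> R) (n K : nat) i j :
  {homo tau : m m' / (m < m')%N >-> m < m'} -> 0 <= tau 0%N -> tau n <= 1 ->
  (\sum_(m < n) \sum_(f : {ffun J -> 'I_K})
    [&& [forall j', (a j' (tau m) == f j') && (a j' (tau m.+1) == f j' + (j' == j))%N],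
      pick (j, val (f j)) == Some i &
      (count (fun v => pick v == Some i) (agents (fun j' => val (f j'))) < cap M i)%N]
    <= serves (samp M a pick) i j)%N.
Proof.
move=> tau_lt tau0 tau1.
pose E (m : 'I_n) := [&& [forall j', a j' (tau m.+1) == a j' (tau m) + (j' == j)]%N,
  pick (j, a j (tau m)) == Some i &
  (count (fun v => pick v == Some i) (agents (fun j' => a j' (tau m))) < cap M i)%N].
have tau_ge0 m : 0 <= tau m.
  by case: m => // m; apply: (le_trans tau0); exact/ltW/tau_lt.
have tau_le1 (m : 'I_n) : tau m.+1 <= 1.
  apply: le_trans tau1; have := ltn_ord m; rewrite leq_eqVlt => /predU1P[->//|h].
  exact/ltW/tau_lt.
have EP m : E m -> [/\ forall j', a j' (tau m.+1) = (a j' (tau m) + (j' == j))%N,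
    pick (j, a j (tau m)) = Some i &
    (count (fun v => pick v == Some i) (agents (fun j' => a j' (tau m))) < cap M i)%N].
  by case/and3P => /forallP h /eqP h1 h2; split => // j'; exact/eqP.
apply: (@leq_trans (\sum_(m < n) E m)).
  apply: leq_sum => m _.
  (* At most one [f] agrees with the counts at [tau m], and none does if some count reaches [K]. *)
  have [[f0 hf0]|nof] := pselect (exists f : {ffun J -> 'I_K},
      forall j', a j' (tau m) = f j'); last first.
    rewrite big1// => f _; case: forallP => //= h; case: nof; exists f => j'.
    by have /andP[/eqP] := h j'.
  rewrite (bigD1 f0)//= big1 ?addn0 => [|f ff0].
    have e : (fun j' => val (f0 j')) = (fun j' => a j' (tau m)).
      by apply/funext => j'; rewrite hf0.
    rewrite e -hf0 /E; case: forallP => //= h.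
    suff -> : [forall j', (a j' (tau m.+1) == a j' (tau m) + (j' == j))%N] by [].
    by apply/forallP => j'; have /andP[_] := h j'; rewrite hf0.
  case: forallP => //= h; case/eqP: ff0; apply/ffunP => j'; apply/val_inj => /=.
  by have /andP[/eqP <- _] := h j'; rewrite hf0.
rewrite -big_mkcond/= sum1_card.
have -> : #|E| = size [seq (i, (j, a j (tau m))) | m : 'I_n <- enum E].
  by rewrite size_map -cardE.
rewrite /serves -size_filter; apply: uniq_leq_size.
  (* The arrival in interval [m] raises the count of type [j], so the agents of later intervals have
     larger indices. *)
  rewrite map_inj_in_uniq ?enum_uniq// => m m'; rewrite !mem_enum => Em Em' [].
  wlog: m m' Em Em' / (m <= m')%N.
    move=> h e; have [mm'|/ltnW mm'] := leqP m m'; first exact: h.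
    by apply/esym; apply: h.
  rewrite leq_eqVlt => /predU1P[mm' _|mm' e]; first exact/val_inj.
  have [/(_ j) + _ _] := EP _ Em; rewrite eqxx addn1 => h.
  have : (a j (tau m.+1) <= a j (tau m'))%N.
    apply: a_mono => //.
      by move: mm'; rewrite leq_eqVlt => /predU1P[->//|mm']; exact/ltW/tau_lt.
    by apply: le_trans (tau_le1 m'); exact/ltW/tau_lt.
  by rewrite h e ltnn.
move=> p /mapP[m]; rewrite mem_enum => /EP[h1 h2 h3] ->.
rewrite mem_filter /= !eqxx/=.
apply: (single_arrival_mem_samp (t := tau m.+1)) => //.
exact: tau_lt.
Qed.

End sampled_matching.

(** * The LP bounds the clairvoyant optimum *)

Lemma sum_serves_load (I J : finType) (y : matching I J) i :
  (\sum_j serves y i j = load y i)%N.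
Proof.
elim: y => [|[i' v] y IH]; first by rewrite big1.
rewrite /serves /load /= big_split/= -/(load y i) -IH; congr addn.
case: eqP => _ /=; last by rewrite big1.
by rewrite (bigD1 v.1)//= eqxx big1 ?addn0// => j /negbTE; rewrite eq_sym => ->.
Qed.

Section valid.
Context (R : realType) (I J : finType) (M : market R I J).
Variables (a : realization R J) (y : matching I J).
Hypothesis vy : valid_matching M a y.

Lemma serves_nonedge i j : ~~ edge M i j -> serves y i j = 0%N.
Proof.
move=> ne; apply/eqP; rewrite /serves -leqn0 leqNgt -has_count; apply/hasPn.
move=> [i' v] iy /=; apply: contra ne => /andP[/eqP <- /eqP <-].
by case: vy => _ /(_ _ _ iy)[].
Qed.

Lemma served_le_arrivals j : (served y j <= a j 1%R)%N.
Proof.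
case: vy => uy hy _; rewrite /served -(count_map snd (fun v => v.1 == j)).
rewrite -size_filter -[leqRHS](size_iota 0) -[leqRHS](size_map (pair j)).
apply: uniq_leq_size; first exact: filter_uniq.
move=> [j' k]; rewrite mem_filter /= => /andP[/eqP -> /mapP[[i v] iy /= e]].
rewrite map_f// mem_iota add0n /=.
by have [_] := hy _ _ iy; rewrite -e.
Qed.

Lemma serves_le_cap i j : (serves y i j <= cap M i)%N.
Proof.
case: vy => _ _ /(_ i); apply: leq_trans.
by rewrite -sum_serves_load (bigD1 j)//= leq_addr.
Qed.

End valid.

Section clairvoyant_bound.
Context (R : realType) (I J : finType) (M : market R I J).
Context (d : measure_display) (T : measurableType d) (P : probability T R).
Variable N : J -> R -> T -> nat.
Hypothesis hN : independent_poisson_processes P (rate M) N.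
Context (d' : measure_display) (U : measurableType d') (Q : probability U R).
Variable A : realization R J -> U -> matching I J.
Hypothesis cA : clairvoyant M N A.

Let y (z : T * U) := A (realized N z.1) z.2.
Let vy z : valid_matching M (realized N z.1) (y z) := cA.1 z.1 z.2.

(** Matchings form a countable type, so a preimage is a countable union, enumerated by [unpickle],
    of events made measurable by [clairvoyant]. *)
Lemma measurable_of_matching (h : matching I J -> \bar R) :
  measurable_fun setT (fun z : T * U => h (y z)).
Proof.
move=> _ Y _; rewrite setTI.
pose B (o : option (matching I J)) := if o is Some y' then
  if h y' \in Y then [set z : T * U | A (realized N z.1) z.2 = y'] else set0
  else set0.
rewrite [X in measurable X](_ : _ = \bigcup_n B (unpickle n)); last first.
  apply/seteqP; split => z.
    move=> Yz; exists (pickle (y z)) => //; rewrite pickleK /B ifT//.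
    exact/mem_set.
  case=> n _; rewrite /B; case: (unpickle n) => // y'.
  by case: ifPn => // /set_mem Yy' /= yz; rewrite /= /y yz.
apply: bigcupT_measurable => n; rewrite /B; case: (unpickle n) => // y'.
by case: ifP => // _; exact: cA.2.
Qed.

Lemma product_measure_setT : (P \x Q)%E [set: T * U] = 1%E.
Proof.
rewrite -setXTT product_measure1E//.
by rewrite [X in (X * _)%E](probability_setT P) mul1e; exact: probability_setT.
Qed.

Let E (g : T * U -> nat) : \bar R := (\int[(P \x Q)%E]_z (g z)%:R%:E)%E.

Let X i j : R := fine (E (fun z => serves (y z) i j)).

(** The capacity bounds the integrand, so the expectation is finite and [fine] loses nothing. *)
Lemma integral_serves i j : E (fun z => serves (y z) i j) = (X i j)%:E.
Proof.
rewrite /X fineK// ge0_fin_numE; last by apply: integral_ge0 => z _; rewrite lee_fin.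
apply: (@le_lt_trans _ _ (\int[(P \x Q)%E]_z (cap M i)%:R%:E)%E).
  apply: ge0_le_integralT => z; first by rewrite lee_fin.
  by rewrite lee_fin ler_nat (serves_le_cap (vy z)).
by rewrite integral_cst// [X in (_ * X)%E]product_measure_setT mule1 ltry.
Qed.

Lemma X_ge0 i j : 0 <= X i j.
Proof. by rewrite fine_ge0//; apply: integral_ge0 => z _; rewrite lee_fin. Qed.

Lemma integral_sum_serves (K : finType) (D : pred K) (i : K -> I) (j : K -> J) :
  E (fun z => \sum_(k | D k) serves (y z) (i k) (j k))%N =
  (\sum_(k | D k) X (i k) (j k))%:E.
Proof.
rewrite -sumEFin big_mkcond.
rewrite [RHS](_ : _ = \sum_k \int[(P \x Q)%E]_z
    (if D k then serves (y z) (i k) (j k) else 0%N)%:R%:E)%E; last first.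
  apply: eq_bigr => k _; case: (D k); first by rewrite -integral_serves.
  by rewrite integral0_eq.
rewrite -ge0_integral_sum//; last 2 first.
- move=> k; exact: (measurable_of_matching
    (fun z => (if D k then serves z (i k) (j k) else 0%N)%:R%:E)).
- by move=> k z _; rewrite lee_fin.
apply: eq_integral => z _; rewrite sumEFin -natr_sum; congr (_%:R%:E).
by rewrite big_mkcond.
Qed.

Lemma integral_served (G : {set J}) :
  E (fun z => \sum_(j in G) served (y z) j)%N =
  (\sum_(j in G) \sum_(i | edge M i j) X i j)%:E.
Proof.
rewrite (pair_big_dep (fun j => j \in G) (fun j i => edge M i j)
  (fun j i => X i j))/=.
rewrite -(integral_sum_serves (fun k : J * I => (k.1 \in G) && edge M k.2 k.1)
   (fun k => k.2) (fun k => k.1)).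
apply: eq_integral => z _; congr (_%:R%:E).
rewrite -(pair_big_dep (fun j => j \in G) (fun j i => edge M i j)
  (fun j i => serves (y z) i j))/=.
apply: eq_bigr => j _; rewrite served_sum [RHS]big_mkcond/=.
apply: eq_bigr => i _; case: ifPn => // ne.
exact: (serves_nonedge (vy z)).
Qed.

Lemma X_cap i : \sum_(j | edge M i j) X i j <= (cap M i)%:R.
Proof.
rewrite -lee_fin -(integral_sum_serves (fun j => edge M i j) (fun=> i) id).
apply: (@le_trans _ _ (\int[(P \x Q)%E]_z (cap M i)%:R%:E)%E); last first.
  by rewrite integral_cst// [X in (_ * X)%E]product_measure_setT mule1.
apply: ge0_le_integralT => z; rewrite lee_fin// ler_nat.
case: (vy z) => _ _ /(_ i); apply: leq_trans.
rewrite -sum_serves_load [leqRHS](bigID (fun j => edge M i j))/=.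
exact: leq_addr.
Qed.

Lemma X_rate j : \sum_(i | edge M i j) X i j <= rate M j.
Proof.
have := integral_served [set j]; rewrite big_set1 -lee_fin => <-.
have m01 : 0 <= (1 : R) <= 1 by rewrite ler01 lexx.
have mN : measurable_fun setT (fun w => (N j 1 w)%:R%:E : \bar R).
  apply/measurable_EFinP.
  have h : measurable_fun setT (fun k : nat => k%:R : R) by [].
  exact: (measurableT_comp h (pp_measurable (hN.1 j) m01)).
apply: (@le_trans _ _ (\int[(P \x Q)%E]_z (N j 1 z.1)%:R%:E)%E).
  apply: ge0_le_integralT => z; rewrite lee_fin// ler_nat big_set1.
  by have := served_le_arrivals (vy z) j; rewrite /realized m01.
(* Integrating out the seed leaves the mean of [N j 1] under [P]. *)
rewrite fubini_tonelli1; last 2 first.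
- exact: (measurableT_comp mN measurable_fst).
- by move=> z; rewrite lee_fin.
apply: le_trans (poisson_process_mean (rate_gt0 M j) (hN.1 j)).
rewrite le_eqVlt; apply/orP; left; apply/eqP; apply: eq_integral => w _.
by rewrite /fubini_F/= integral_cst// [X in (_ * X)%E](probability_setT Q) mule1.
Qed.

Lemma expectation_served (G : {set J}) :
  'E_(P \x Q)[fun z => (\sum_(j in G) served (A (realized N z.1) z.2) j)%N%:R]%E =
  (\sum_(j in G) \sum_(i | edge M i j) X i j)%:E.
Proof. by rewrite expectation.unlock; exact: integral_served. Qed.

Lemma fairness_le G : G \in groups M -> (fairness M P N Q A <=
  'E_(P \x Q)[fun z => (\sum_(j in G) served (A (realized N z.1) z.2) j)%N%:R]
      / (\sum_(j in G) rate M j)%R%:E)%E.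
Proof. by move=> Gg; rewrite /fairness (bigD1 G)//= ge_min lexx. Qed.

(** The pair formed by [X] and the fairness is feasible for the LP. The group [G0] makes the minimum
    finite, as the LP value must be a real number. *)
Lemma clairvoyant_fairness_le x s G0 : lp_optimal M x s -> G0 \in groups M ->
  (fairness M P N Q A <= s%:E)%E.
Proof.
move=> [_ opt] G0g; set f := fairness M P N Q A.
have X0 G : 0 <= \sum_(j in G) \sum_(i | edge M i j) X i j.
  by apply: sumr_ge0 => j _; apply: sumr_ge0 => i _; exact: X_ge0.
have r0 (G : {set J}) : 0 <= \sum_(j in G) rate M j.
  by apply: sumr_ge0 => j _; exact/ltW/rate_gt0.
have f0 : (0 <= f)%E.
  rewrite /f /fairness; elim/big_ind: _ => // [u v u0 v0|G Gg]; first by rewrite le_min u0.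
  by rewrite expectation_served mule_ge0 ?inve_ge0 ?lee_fin.
have ffin : f \is a fin_num.
  rewrite ge0_fin_numE//; apply: le_lt_trans (fairness_le G0g) _.
  (* A group of total rate 0 is empty, rates being positive, so its quotient is [0 * +oo = 0]. *)
  rewrite expectation_served inver; case: eqP => [e|_]; last by rewrite -EFinM ltry.
  rewrite big1 ?mul0e// => j jG; have /eqP := e.
  rewrite psumr_eq0 => [|k _]; last exact/ltW/rate_gt0.
  by move/allP/(_ j (mem_index_enum _)); rewrite jG /= gt_eqF ?rate_gt0.
rewrite -(fineK ffin) lee_fin; apply: (opt X); split => //.
- exact: X_cap.
- move=> G Gg; have [->|rn0] := eqVneq (\sum_(j in G) rate M j) 0.
    by rewrite mulr0.
  have := fairness_le Gg; rewrite -/f expectation_served inver (negbTE rn0).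
  by rewrite -EFinM -{1}(fineK ffin) lee_fin ler_pdivlMr// lt_neqAle eq_sym rn0 r0.
- exact: X_rate.
- exact: fine_ge0.
- by move=> i j _; exact: X_ge0.
Qed.

End clairvoyant_bound.

(** * The guarantee of SAMP *)

Lemma sum_pair3 (V : nmodType) (A B C : finType) (D : pred A)
    (F : A -> B -> C -> V) :
  \sum_(k : A * (B * C) | D k.1) F k.1 k.2.1 k.2.2 =
  \sum_(q | D q) \sum_m \sum_f F q m f.
Proof.
under [RHS]eq_bigr do rewrite pair_bigA /=.
rewrite (pair_big D xpredT (fun q mf => F q mf.1 mf.2))/=.
by apply: eq_bigl => k; rewrite andbT.
Qed.

Lemma cvg_le_bound (R : realType) (u : nat -> R) (l r : R) :
  u n @[n --> \oo] --> l -> (forall n, u n <= r) -> l <= r.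
Proof.
move=> ul ur; rewrite -(cvg_lim _ ul)//; apply: limr_le; last exact: nearW.
by apply/cvg_ex; exists l.
Qed.

Section samp_bound.
Context (R : realType) (I J : finType) (M : market R I J).
Context (d : measure_display) (T : measurableType d) (P : probability T R).
Variable N : J -> R -> T -> nat.
Hypothesis hN : independent_poisson_processes P (rate M) N.
Variable x : I -> J -> R.
Hypothesis x_ge0 : forall i j, edge M i j -> 0 <= x i j.
Hypothesis x_cap : forall i, \sum_(j | edge M i j) x i j <= (cap M i)%:R.
Context (d' : measure_display) (U : measurableType d') (Q : probability U R).
Variable pick : U -> J * nat -> option I.
Hypothesis hpick : samp_picks M Q x pick.

(** Extension by 0 off the edges, where [x] is arbitrary, lets sums and products run over all
    types. *)
Let p i j : R := if edge M i j then x i j / rate M j else 0.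

Lemma rate_neq0 j : rate M j != 0.
Proof. by rewrite gt_eqF ?rate_gt0. Qed.

Lemma sigma_pick_measurable v (A : set U) :
  sigma_rv (pick ^~ v) A -> measurable A.
Proof.
case=> B _ <-; rewrite setTI.
rewrite [X in measurable X](_ : _ = \bigcup_(o in B) [set u | pick u v = o]).
  apply: fin_bigcup_measurable; first exact: finite_finset.
  by move=> o _; exact: (picks_measurable hpick).
by apply/seteqP; split => u /=; [move=> Bu; exists (pick u v)|move=> [c Bc /= pc]; rewrite pc].
Qed.

Lemma sigma_pick_set v (B : set (option I)) :
  sigma_rv (pick ^~ v) [set u | B (pick u v)].
Proof. by exists B => //; rewrite setTI. Qed.

Lemma prob_pick i v : Q [set u | pick u v == Some i] = (p i v.1)%:E.
Proof.
have -> : [set u | pick u v == Some i] = [set u | pick u v = Some i].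
  by apply/seteqP; split => u /= /eqP.
rewrite /p; case: ifPn => [|ne]; first exact: (picks_law hpick).
rewrite (_ : [set u | _] = set0) ?measure0//; apply/seteqP; split => u //=.
by move/(picks_edge hpick); rewrite (negbTE ne).
Qed.

Let arrivals_event (tau : nat -> R) j m (f : J -> nat) := [set w | forall j',
  N j' (tau m) w = f j' /\ N j' (tau m.+1) w = (f j' + (j' == j))%N].

(** After counts [f], the next agent of type [j] is [(j, f j)], and [agents f] lists those who came
    before. *)
Let picks_event i j (f : J -> nat) := [set u | pick u (j, f j) == Some i] `&`
  [set u | (count (fun v => pick u v == Some i) (agents f) < cap M i)%N].

Lemma prob_picks_event i j f : measurable (picks_event i j f) /\
  Q (picks_event i j f) = (p i j *
    \sum_(l < cap M i) (\prod_j' bern_gf (p i j') ^+ f j')`_l)%:E.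
Proof.
rewrite -(@prod_agents _ _ f (fun j => bern_gf (p i j))).
apply: (@prob_count_lt _ _ _ _ _ _ (picks_indep hpick) sigma_pick_measurable
  (fun u v => pick u v == Some i) (fun v => p i v.1) _ _ _ (agents f) (j, f j)).
- by move=> v; exact: (sigma_pick_set v (fun o => o == Some i)).
- by move=> v; exact: (sigma_pick_set v (fun o => o != Some i)).
- exact: prob_pick.
- by rewrite cons_uniq agents_uniq mem_agents ltnn.
- exact: (sigma_pick_set _ (fun o => o == Some i)).
- exact: (prob_pick i (j, f j)).
Qed.

Variable G : {set J}.

Let E := (\int[(P \x Q)%E]_z
  (\sum_(j in G) served (samp M (realized N z.1) (pick z.2)) j)%N%:R%:E)%E.

Let h n : R := n%:R^-1.
Let tau n m : R := m%:R / n%:R.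
Let lam : R := \sum_j rate M j.

Let D (q : J * I) := (q.1 \in G) && edge M q.2 q.1.

(** The probability that a grid interval contains exactly one arrival, of type [q.1], and that this
    agent picks [q.2]. *)
Let weight n (q : J * I) := rate M q.1 * h n * expR (- (lam * h n)) * p q.2 q.1.

(** Every summand is the probability of a rectangle, an arrival event times a pick event, and
    [serves_samp_ge] bounds the sum of their indicators by the number served. *)
Lemma grid_bound_le n K : (0 < n)%N ->
  ((\sum_(q | D q) \sum_(m < n) weight n q *
     \sum_(f : {ffun J -> 'I_K}) (\prod_j pois (rate M j * tau n m) (f j)) *
        \sum_(l < cap M q.2) (\prod_j bern_gf (p q.2 j) ^+ f j)`_l)%:E <= E)%E.
Proof.
move=> n0; have n0' : 0 < n%:R :> R by rewrite ltr0n.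
have tau_lt : {homo tau n : m m' / (m < m')%N >-> m < m'}.
  by move=> m m' mm'; rewrite /tau ltr_pM2r ?invr_gt0// ltr_nat.
have tau0 m : 0 <= tau n m by rewrite /tau divr_ge0.
have tau1 m : (m < n)%N -> tau n m.+1 <= 1.
  by move=> mn; rewrite /tau ler_pdivrMr// mul1r ler_nat.
have dtau m : tau n m.+1 - tau n m = h n.
  by rewrite /tau /h -mulrBl -natr1 addrAC subrr add0r mul1r.
pose S (k : (J * I) * ('I_n * {ffun J -> 'I_K})) :=
  arrivals_event (tau n) k.1.1 k.2.1 (fun j => val (k.2.2 j)) `*`
  picks_event k.1.2 k.1.1 (fun j => val (k.2.2 j)).
have hA j (m : 'I_n) f := independent_poisson_single_arrival f
  (fun j' => nat_of_bool (j' == j)) (@rate_gt0 _ _ _ M) hN (tau0 m)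
  (tau_lt _ _ (ltnSn m)) (tau1 m (ltn_ord m)).
have -> : (\sum_(q | D q) \sum_(m < n) weight n q *
     \sum_(f : {ffun J -> 'I_K}) (\prod_j pois (rate M j * tau n m) (f j)) *
        \sum_(l < cap M q.2) (\prod_j bern_gf (p q.2 j) ^+ f j)`_l)%:E =
    (\sum_(k | D k.1) (P \x Q)%E (S k))%E.
  under eq_bigr => q _ do under eq_bigr => m _ do rewrite mulr_sumr.
  rewrite -(sum_pair3 D (fun q (m : 'I_n) (f : {ffun J -> 'I_K}) =>
    weight n q * ((\prod_j pois (rate M j * tau n m) (f j)) *
        \sum_(l < cap M q.2) (\prod_j bern_gf (p q.2 j) ^+ f j)`_l))).
  rewrite -sumEFin; apply: eq_bigr => k _.
  have [mA PA] := hA k.1.1 k.2.1 (fun j => val (k.2.2 j)).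
  have [mB QB] := prob_picks_event k.1.2 k.1.1 (fun j => val (k.2.2 j)).
  rewrite product_measure1E// [X in _ = (X * _)%E]PA [X in _ = (_ * X)%E]QB.
  rewrite -EFinM dtau prod_pois_delta /weight -/lam; congr (_%:E).
  ring.
apply: sum_measure_le_integral.
  move=> k _; have [mA _] := hA k.1.1 k.2.1 (fun j => val (k.2.2 j)).
  have [mB _] := prob_picks_event k.1.2 k.1.1 (fun j => val (k.2.2 j)).
  exact: measurableX.
move=> [w u].
pose F (q : J * I) (m : 'I_n) (f : {ffun J -> 'I_K}) : nat :=
  [&& [forall j', (realized N w j' (tau n m) == f j') &&
        (realized N w j' (tau n m.+1) == f j' + (j' == q.1))%N],
      pick u (q.1, val (f q.1)) == Some q.2 &
      (count (fun v => pick u v == Some q.2) (agents (fun j' => val (f j')))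
        < cap M q.2)%N].
have SF k : \1_(S k) (w, u) = (F k.1 k.2.1 k.2.2)%:R :> R.
  rewrite indicE; congr (_%:R); congr nat_of_bool.
  have t0 : 0 <= tau n k.2.1 <= 1.
    by rewrite tau0 (le_trans (ltW (tau_lt _ _ (ltnSn _)))) ?tau1.
  have t1 : 0 <= tau n k.2.1.+1 <= 1 by rewrite tau0 tau1.
  apply/idP/idP.
    move=> /set_mem[/= hA' [/= h1 h2]]; rewrite h1 h2 !andbT.
    by apply/forallP => j'; rewrite /realized t0 t1; have [-> ->] := hA' j'; rewrite !eqxx.
  case/and3P => /forallP h0 h1 h2; apply/mem_set; split => //= j'.
  by have := h0 j'; rewrite /realized t0 t1 => /andP[/eqP -> /eqP ->].
rewrite (eq_bigr (fun k => (F k.1 k.2.1 k.2.2)%:R%:E)); last first.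
  by move=> k _; congr (_%:E); exact: SF.
rewrite sumEFin lee_fin -natr_sum ler_nat (sum_pair3 D F).
set y := samp _ _ _.
have -> : (\sum_(j in G) served y j = \sum_(j in G) \sum_i serves y i j)%N.
  by apply: eq_bigr => j _; exact: served_sum.
apply: (@leq_trans (\sum_(j in G) \sum_(i | edge M i j) serves y i j)%N); last first.
  by apply: leq_sum => j _; rewrite [leqRHS](bigID (fun i => edge M i j))/= leq_addr.
rewrite (pair_big_dep (fun j => j \in G) (fun j i => edge M i j)
  (fun j i => serves y i j))/=.
apply: leq_sum => q _; apply: serves_samp_ge => //.
- move=> j s t s0 st t1; rewrite /realized s0 t1 (le_trans s0 st) (le_trans st t1).
  exact: (pp_nondecreasing (hN.1 j)).
- move=> j t /[dup] t01 /andP[t0 t1].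
  have := pp_right_continuous (hN.1 j) w t01.
  apply: filter_app; near=> v.
  rewrite /realized t0 (ltW t1)/= ifT//.
  apply/andP; split; first by apply: (le_trans t0); near: v; exact: nbhs_right_ge.
  by near: v; exact: nbhs_right_le.
- by case: n n0 {n0' tau_lt tau0 dtau S hA F SF} tau1 => // n _ tau1; exact: tau1.
Unshelve. all: by end_near.
Qed.

Lemma mean_demand i n m :
  \sum_j rate M j * tau n m * p i j = (\sum_(j | edge M i j) x i j) * tau n m.
Proof.
rewrite mulr_suml [RHS]big_mkcond/=; apply: eq_bigr => j _; rewrite /p.
case: ifP => _; last by rewrite mulr0.
by field; exact: rate_neq0.
Qed.

(** Two limits are taken in turn: [K] to infinity on a fixed grid, which produces [pois_cdf] at the
    mean demand, then [n] to infinity, which sends the loss factor [expR (- (lam * h n))] to 1. *)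
Lemma samp_served_ge (b : nat) : (0 < b)%N -> (forall i, (b <= cap M i)%N) ->
  ((samp_ratio R b * \sum_(j in G) \sum_(i | edge M i j) x i j)%:E <= E)%E.
Proof.
move=> b0 b_cap.
have E0 : (0 <= E)%E by apply: integral_ge0 => z _; rewrite lee_fin.
have [->|Efin] := eqVneq E +oo%E; first exact: leey.
have {}Efin : E \is a fin_num by rewrite ge0_fin_numE// lt_neqAle Efin leey.
rewrite -(fineK Efin) lee_fin; set c := samp_ratio R b * _.
have W n : (0 < n)%N -> expR (- (lam * h n)) * c <= fine E.
  move=> n0; have n0' : 0 < n%:R :> R by rewrite ltr0n.
  apply: (@le_trans _ _ (\sum_(q | D q) \sum_(m < n) weight n q *
      pois_cdf (cap M q.2) (\sum_j rate M j * tau n m * p q.2 j))); last first.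
    apply: (@cvg_le_bound _ (fun K => \sum_(q | D q) \sum_(m < n) weight n q *
      \sum_(f : {ffun J -> 'I_K}) (\prod_j pois (rate M j * tau n m) (f j)) *
        \sum_(l < cap M q.2) (\prod_j bern_gf (p q.2 j) ^+ f j)`_l)).
      apply: cvg_big => [|q _]; first exact: add_continuous.
      apply: cvg_big => [|m _]; first exact: add_continuous.
      by apply: cvgM; [exact: cvg_cst|exact: pois_mixture_cvg].
    by move=> K; rewrite -lee_fin (fineK Efin); exact: grid_bound_le.
  rewrite /c (pair_big_dep (fun j => j \in G) (fun j i => edge M i j)
    (fun j i => x i j))/= !mulr_sumr.
  apply: ler_sum => -[j i] /andP[/= jG ij].
  have weightE : weight n (j, i) = expR (- (lam * h n)) * x i j * h n.
    by rewrite /weight /p/= ij; field; exact: rate_neq0.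
  under eq_bigr do rewrite weightE mean_demand -mulrA.
  rewrite -mulr_sumr mulrCA [leLHS]mulrC ler_wpM2l//.
    by rewrite mulr_ge0 ?expR_ge0 ?x_ge0.
  apply: le_trans (samp_ratio_le R b0 (b_cap i)) _.
  apply: samp_ratio_riemann => //; first exact: leq_trans (b_cap i).
  by rewrite x_cap andbT sumr_ge0// => j' ij'; exact: x_ge0.
apply: (@cvg_le_bound _ (fun n => expR (- (lam * h n.+1)) * c)); last first.
  by move=> n; exact: W.
rewrite -[X in _ --> X]mul1r -expR0; apply: cvgM; last exact: cvg_cst.
apply: continuous_cvg; first exact: continuous_expR.
rewrite -oppr0 -(mulr0 lam); apply: cvgN; apply: cvgM; first exact: cvg_cst.
exact: cvg_harmonic.
Qed.

End samp_bound.

(** * From the two bounds to the competitive ratio *)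

Lemma min_cap_le (R : realType) (I J : finType) (M : market R I J) i :
  (min_cap M <= cap M i)%N.
Proof.
rewrite /min_cap; move: (\max_(i' : I) _)%N (mem_index_enum i) => z.
elim: (index_enum I) => // i' r IH; rewrite inE big_cons geq_min.
by case/predU1P => [->|/IH ->]; rewrite ?leqnn ?orbT.
Qed.

Lemma min_cap_gt0 (R : realType) (I J : finType) (M : market R I J) (i : I) :
  (0 < min_cap M)%N.
Proof.
rewrite /min_cap; elim/big_ind: _ => [|m n m0 n0|i' _]; last exact: cap_gt0.
  by rewrite (bigD1 i)//= leq_max cap_gt0.
by rewrite leq_min m0.
Qed.

Theorem theorem4 (R : realType) :
  (forall (I J : finType) (M : market R I J)
     (d : measure_display) (T : measurableType d) (P : probability T R)
     (N : J -> R -> T -> nat)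
     (hN : independent_poisson_processes P (rate M) N)
     (x : I -> J -> R) (s : R) (hx : lp_optimal M x s)
     (d' : measure_display) (U : measurableType d') (Q : probability U R)
     (pick : U -> J * nat -> option I) (hpick : samp_picks M Q x pick),
     ((samp_ratio R (min_cap M))%:E * clairvoyant_opt M P N
        <= fairness M P N Q (fun a u => samp M a (pick u)))%E) /\
  (forall m n : nat, (0 < m)%N -> (m < n)%N ->
     samp_ratio R m < samp_ratio R n) /\
  samp_ratio R n @[n --> \oo] --> (1 : R).
Proof.
split; last by split; [exact: samp_ratio_lt|exact: samp_ratio_cvg].
move=> I J M d T P N hN x s hx d' U Q pick hpick.
have r_ge0 := samp_ratio_ge0 R (min_cap M).
have [x_cap x_fair _ s0 x_ge0] := hx.1.
rewrite [leRHS]/fairness; elim/big_ind: _ => [|u v hu hv|G Gg].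
- exact: leey.
- by rewrite le_min hu.
have opt_le c : (forall d'' (V : measurableType d'') (Q' : probability V R) A,
    clairvoyant M N A -> (fairness M P N Q' A <= c)%E) ->
    (clairvoyant_opt M P N <= c)%E.
  by move=> h; apply: ge_ereal_sup => _ [d'' [V [Q' [A [cA ->]]]]]; exact: h.
(* For an empty group the quotient is 0 for SAMP and for every clairvoyant algorithm. *)
have [G0|[j0 j0G]] := set_0Vmem G.
  rewrite [leRHS](_ : _ = 0%E).
    rewrite mule_ge0_le0 ?lee_fin//; apply: opt_le => d'' V Q' A cA.
    apply: le_trans (fairness_le P N Q' A Gg) _.
    by rewrite (expectation_served P Q' cA) G0 !big_set0 mul0e.
  rewrite expectation.unlock [X in (X * _)%E]integral0_eq ?mul0e// => z _.
  by rewrite G0 big_set0.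
have rG0 : 0 < \sum_(j in G) rate M j.
  rewrite (bigD1 j0)//= ltr_pwDl ?rate_gt0// sumr_ge0// => j _.
  exact/ltW/rate_gt0.
have opt_s : (clairvoyant_opt M P N <= s%:E)%E.
  by apply: opt_le => d'' V Q' A cA; exact: (clairvoyant_fairness_le hN Q' cA hx Gg).
apply: (@le_trans _ _ (samp_ratio R (min_cap M) * s)%:E).
  by rewrite EFinM lee_wpmul2l ?lee_fin.
rewrite inver gt_eqF// lee_pdivlMr// -EFinM expectation.unlock.
have [i0|noI] := pselect (exists i : I, true).
  case: i0 => i0 _.
  have E_ge := samp_served_ge hN x_ge0 x_cap hpick G (min_cap_gt0 M i0)
    (min_cap_le M).
  apply: le_trans E_ge.
  by rewrite lee_fin -mulrA ler_wpM2l// x_fair.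
(* Without offline agents [min_cap] is 0, outside the reach of [samp_served_ge], but the LP
   constraint of [G] then has right side 0. *)
have s_le0 : s * \sum_(j in G) rate M j <= 0.
  apply: le_trans (x_fair G Gg) _; rewrite big1// => j _.
  by rewrite big1// => i; case: noI; exists i.
apply: (@le_trans _ _ 0%E); first by rewrite lee_fin -mulrA mulr_ge0_le0.
by apply: integral_ge0 => z _; rewrite lee_fin.
Qed.
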